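(* Let $\alpha$ be the (real) stabilization parameter and $h$ the mesh size, and consider the Streamline-Upwind stabilized Global Flux (SU-GF) scheme $$ \begin{aligned} 0={}&M_x\otimes M_y\,\partial_t\mathrm u+D_x\otimes M_y(\mathrm p-\mathrm K_u)+\alpha h\Bigl(D^x\otimes M_y\,\partial_t\mathrm p+D^x_x\otimes D_y(\mathrm U+\mathrm V-\mathrm K_p)\Bigr),\\ 0={}&M_x\otimes M_y\,\partial_t\mathrm v+M_x\otimes D_y(\mathrm p-\mathrm K_v)+\alpha h\Bigl(M_x\otimes D^y\,\partial_t\mathrm p+D_x\otimes D^y_y(\mathrm U+\mathrm V-\mathrm K_p)\Bigr),\\ 0={}&M_x\otimes M_y\,\partial_t\mathrm p+D_x\otimes D_y(\mathrm U+\mathrm V-\mathrm K_p)\\ &+\alpha h\Bigl(D^x\otimes M_y\,\partial_t\mathrm u+D^x_x\otimes M_y(\mathrm p-\mathrm K_u)\Bigr)+\alpha h\Bigl(M_x\otimes D^y\,\partial_t\mathrm v+M_x\otimes D^y_y(\mathrm p-\mathrm K_v)\Bigr), \end{aligned} $$ with $\mathrm U=\mathbf 1_x\otimes I_y\,\mathrm u$, $\mathrm V=I_x\otimes \mathbf 1_y\,\mathrm v$, $\mathrm K_u=I_x\otimes\mathbf 1_y\,\mathrm S_u$, $\mathrm K_v=\mathbf 1_x\otimes I_y\,\mathrm S_v$, $\mathrm K_p=I_x\otimes I_y\,\mathrm S_p$ (notation as in the context). This stabilized scheme admits the discrete steady states characterized by each of the following two conditions; that is, whenever $(\mathrm u,\mathrm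 v,\mathrm p)$ satisfies (A), and likewise whenever it satisfies (B), the spatial (time-derivative-free) part of each of the three equations vanishes. (A) At all nodes $(i,k;j,s)$: $\mathrm p_{i,k;j,s}-(\mathrm K_u)_{i,k;j,s}=\sigma^y_u(j,s)$, $\mathrm p_{i,k;j,s}-(\mathrm K_v)_{i,k;j,s}=\sigma^x_v(i,k)$, and $\mathrm U_{i,k;j,s}+\mathrm V_{i,k;j,s}-(\mathrm K_p)_{i,k;j,s}=\sigma^x_p(i,k)+\sigma^y_p(j,s)$, where $\sigma^y_u,\sigma^y_p$ are arbitrary functions of the $y$-node only and $\sigma^x_v,\sigma^x_p$ arbitrary functions of the $x$-node only. (B) For every cell $E_{ij}$ and all $s,t\in\{0,\dots,K\}$, $$ \begin{aligned} &\int_{x_{i,0}}^{x_{i,s}}\bigl(\partial_xp_h-(S_u)_h\bigr)(x,y_{j,t})\,dx=0,\qquad \int_{y_{j,0}}^{y_{j,t}}\bigl(\partial_yp_h-(S_v)_h\bigr)(x_{i,s},y)\,dy=0,\\ &\int_{x_{i,0}}^{x_{i,s}}\int_{y_{j,0}}^{y_{j,t}}\bigl(\partial_xu_h+\partial_yv_h-(S_p)_h\bigr)\,dy\,dx=0 . \end{aligned} $$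
   Context: PDE. The scheme approximates $\partial_t u+\partial_x p=S_u$, $\partial_t v+\partial_y p=S_v$, $\partial_t p+\partial_x u+\partial_y v=S_p$ on a rectangle $\Omega=[x_0,x_e]\times[y_0,y_e]$. The velocity source is $(S_u,S_v)=c(x,y)(v,-u)-f(x,y)(u,v)+\boldsymbol\tau(x,y)$ with given functions $c,f,\boldsymbol\tau$, and $S_p$ is a scalar source. Mesh and spaces. $\Omega$ is divided into uniform Cartesian cells $E_{ij}=[x_i,x_{i+1}]\times[y_j,y_{j+1}]$, $0\le i<N_x$, $0\le j<N_y$, of sizes $\Delta x,\Delta y$, and $h=\min(\Delta x,\Delta y)$. Fix a degree $K\ge 1$. Each cell $[x_i,x_{i+1}]$ carries the $K+1$ Gauss-Lobatto points $x_{i,0}=x_i<\dots<x_{i,K}=x_{i+1}$ (so the nodes $(i,0)$ and $(i-1,K)$ are identified), and similarly $y_{j,0},\dots,y_{j,K}$. Let $\varphi^x_\alpha$ be the continuous piecewise-$\mathbb P^K$ Lagrange basis at the 1D nodes in $x$, and $\varphi^y_\beta$ the one in $y$. $V_h$ is the space spanned by the products $\varphi^x_\alpha(x)\varphi^y_\beta(y)$. A function $q_h\in V_h$ is identified with its array $\mathrm q$ of nodal values, and $(A\otimes B)\mathrm q$ has entries $\sum_{\alpha',\beta'}A_{\alpha\alpha'}B_{\beta\beta'}\mathrm q_{\alpha';\beta'}$. Matrices. $(M_x)_{\alpha\beta}=\int\varphi^x_\alpha\varphi^x_\beta\,dx$, $(D_x)_{\alpha\beta}=\int\varphi^x_\alpha(\varphi^x_\beta)'\,dx$,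 $(D^x)_{\alpha\beta}=\int(\varphi^x_\alpha)'\varphi^x_\beta\,dx$, $(D^x_x)_{\alpha\beta}=\int(\varphi^x_\alpha)'(\varphi^x_\beta)'\,dx$, computed with Gauss-Lobatto quadrature at the nodes (so $M_x$ is diagonal); $M_y,D_y,D^y,D^y_y$ are defined analogously in $y$. $\mathbf 1_x,\mathbf 1_y$ are identity matrices. Integration operators. For a 1D nodal array $\mathrm q$ with interpolant $q_h$, $(I_x\mathrm q)_{i,p}=(I_x\mathrm q)_{i,0}+\int_{x_{i,0}}^{x_{i,p}}q_h(x)\,dx$, with continuity $(I_x\mathrm q)_{i,0}=(I_x\mathrm q)_{i-1,K}$ across cells and initial value $0$ at $x_0$; $I_y$ is analogous. Sources and boundary. $\mathrm S_u,\mathrm S_v,\mathrm S_p$ are the arrays of nodal values of the sources (evaluated at the nodal unknowns where they depend on them), and $(S_u)_h,(S_v)_h,(S_p)_h\in V_h$ the corresponding interpolants. The variational equations are tested with functions of $V_h$ vanishing on $\partial\Omega$ and are complemented by boundary conditions. *)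

(* Defs.v *)
From mathcomp Require Import all_boot all_order all_algebra.
From mathcomp Require Import all_classical all_reals all_analysis.

Set Implicit Arguments.
Unset Strict Implicit.
Unset Printing Implicit Defensive.

Import Order.TTheory GRing.Theory Num.Theory.
Import numFieldNormedType.Exports.

Local Open Scope classical_set_scope.
Local Open Scope ring_scope.

(* Rodrigues' formula. *)
Definition legendre (R : realType) (K : nat) : {poly R} :=
  (2 ^+ K * K`!%:R)^-1 *: (('X^2 - 1) ^+ K)^`(K).

(* The K+1 Gauss-Lobatto points of [-1, 1], in increasing order.  The
   derivative of the Legendre polynomial of degree K has degree K-1, so its
   K-1 roots are exactly the inner points and xi 0, ..., xi K are determined;
   the values xi k for k > K are never used. *)
Definition gauss_lobatto (R : realType) (K : nat) (xi : nat -> R) : Prop :=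
  [/\ xi 0%N = -1, xi K = 1,
      (forall k l : nat, (k < l <= K)%N -> xi k < xi l) &
      (forall k : nat, (0 < k < K)%N -> root (legendre R K)^`() (xi k))].

Record grid (R : realType) := Grid {
  gdeg : nat;          (* the degree K *)
  gref : nat -> R;     (* the Gauss-Lobatto points of [-1, 1] *)
  glo : R;
  ghi : R;
  gcells : nat }.

(* Nodes are numbered 0, ..., N * K: the node (i, k) has number i * K + k, so
   that (i, 0) and (i-1, K) are the same node.  Conversely the node a is
   (a %/ K, a %% K); this writes the last node as (N, 0). *)
Definition nb (R : realType) (X : grid R) : nat := (gcells X * gdeg X).+1.

Definition cell_size (R : realType) (X : grid R) : R :=
  (ghi X - glo X) / (gcells X)%:R.

Definition pt (R : realType) (X : grid R) (i k : nat) : R :=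
  glo X + cell_size X * i%:R + cell_size X * ((1 + gref X k) / 2).

Definition coord_of (R : realType) (X : grid R) (a : 'I_(nb X)) : R :=
  pt X (a %/ gdeg X) (a %% gdeg X).

Definition lagr (R : realType) (X : grid R) (i : nat) (k : 'I_(gdeg X).+1) :
    {poly R} :=
  tnth (lagrange (gdeg X).+1 (pt X i)) k.

(* The restriction to the cell i of the basis function of the node a: the
   Lagrange polynomial of (i, k) if a is the node (i, k) of the cell, and 0 if
   a is not in the cell.  Its derivative is the derivative taken inside the
   cell, hence one-sided at the end points. *)
Definition phi (R : realType) (X : grid R) (i : nat) (a : 'I_(nb X)) :
    {poly R} :=
  \sum_(k < (gdeg X).+1 | (i * gdeg X + k)%N == a) lagr i k.

Definition weight (R : realType) (X : grid R) (i : nat) (k : 'I_(gdeg X).+1) :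
    R :=
  \int[lebesgue_measure]_(x in `[pt X i 0, pt X i (gdeg X)])
     ((lagr i k).[x]).

Definition quad (R : realType) (X : grid R) (i : nat) (g : R -> R) : R :=
  \sum_(k < (gdeg X).+1) weight i k * g (pt X i k).

Definition M_ (R : realType) (X : grid R) : 'M[R]_(nb X) :=
  \matrix_(a, b) \sum_(i < gcells X)
     quad X i (fun x => (phi i a).[x] * (phi i b).[x]).

(* D_x: the derivative is on the trial function b. *)
Definition Dlo_ (R : realType) (X : grid R) : 'M[R]_(nb X) :=
  \matrix_(a, b) \sum_(i < gcells X)
     quad X i (fun x => (phi i a).[x] * ((phi i b)^`()).[x]).

(* D^x: the derivative is on the test function a. *)
Definition Dup_ (R : realType) (X : grid R) : 'M[R]_(nb X) :=
  \matrix_(a, b) \sum_(i < gcells X)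
     quad X i (fun x => ((phi i a)^`()).[x] * (phi i b).[x]).

(* D^x_x *)
Definition Dlu_ (R : realType) (X : grid R) : 'M[R]_(nb X) :=
  \matrix_(a, b) \sum_(i < gcells X)
     quad X i (fun x => ((phi i a)^`()).[x] * ((phi i b)^`()).[x]).

Definition interp1 (R : realType) (X : grid R) (q : 'I_(nb X) -> R) (i : nat)
    (x : R) : R :=
  \sum_(a < nb X) q a * (phi i a).[x].

(* The value of the primitive at the node (i, 0). *)
Fixpoint prim_start (R : realType) (X : grid R) (q : 'I_(nb X) -> R)
    (i : nat) : R :=
  if i is i'.+1 then
    prim_start q i' +
    \int[lebesgue_measure]_(x in `[pt X i' 0, pt X i' (gdeg X)])
       (interp1 q i' x)
  else 0.

Definition prim (R : realType) (X : grid R) (q : 'I_(nb X) -> R)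
    (a : 'I_(nb X)) : R :=
  let i := (a %/ gdeg X)%N in
  prim_start q i +
  \int[lebesgue_measure]_(x in `[pt X i 0, pt X i (a %% gdeg X)])
     (interp1 q i x).

(* The matrix of the linear map prim: its column b is the image of the nodal
   array of the basis function b. *)
Definition I_ (R : realType) (X : grid R) : 'M[R]_(nb X) :=
  \matrix_(a, b) prim (fun c : 'I_(nb X) => (c == b)%:R) a.

Definition kron (R : realType) (m n : nat) (A : 'M[R]_m) (B : 'M[R]_n)
    (q : 'M[R]_(m, n)) : 'M[R]_(m, n) :=
  \matrix_(a, b) \sum_(a' < m) \sum_(b' < n) A a a' * B b b' * q a' b'.

Notation "A '\ox' B" := (kron A B) (at level 40, no associativity) : ring_scope.

(* The values on the cell (i, j) of q_h, of its x-derivative and of its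
   y-derivative. *)
Definition interp (R : realType) (X Y : grid R) (q : 'M[R]_(nb X, nb Y))
    (i j : nat) (x y : R) : R :=
  \sum_(a < nb X) \sum_(b < nb Y) q a b * ((phi i a).[x] * (phi j b).[y]).

Definition dx_interp (R : realType) (X Y : grid R) (q : 'M[R]_(nb X, nb Y))
    (i j : nat) (x y : R) : R :=
  \sum_(a < nb X) \sum_(b < nb Y)
     q a b * (((phi i a)^`()).[x] * (phi j b).[y]).

Definition dy_interp (R : realType) (X Y : grid R) (q : 'M[R]_(nb X, nb Y))
    (i j : nat) (x y : R) : R :=
  \sum_(a < nb X) \sum_(b < nb Y)
     q a b * ((phi i a).[x] * ((phi j b)^`()).[y]).

Definition mesh_size (R : realType) (X Y : grid R) : R :=
  Num.min (cell_size X) (cell_size Y).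

Record sources (R : realType) := Sources {
  coef_c : R -> R -> R;
  coef_f : R -> R -> R;
  tau_u : R -> R -> R;
  tau_v : R -> R -> R;
  src_p : R -> R -> R -> R -> R -> R }.   (* a function of x, y, u, v, p *)

Section Scheme.
Context (R : realType) (X Y : grid R) (alpha : R) (S : sources R).
Local Notation array := 'M[R]_(nb X, nb Y).

Definition S_u (u v : array) : array := \matrix_(a, b)
  let x := coord_of a in let y := coord_of b in
  coef_c S x y * v a b - coef_f S x y * u a b + tau_u S x y.

Definition S_v (u v : array) : array := \matrix_(a, b)
  let x := coord_of a in let y := coord_of b in
  - (coef_c S x y * u a b) - coef_f S x y * v a b + tau_v S x y.

Definition S_p (u v p : array) : array := \matrix_(a, b)
  src_p S (coord_of a) (coord_of b) (u a b) (v a b) (p a b).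

Definition U_ (u : array) : array := (1%:M \ox I_ Y) u.
Definition V_ (v : array) : array := (I_ X \ox 1%:M) v.
Definition K_u (u v : array) : array := (I_ X \ox 1%:M) (S_u u v).
Definition K_v (u v : array) : array := (1%:M \ox I_ Y) (S_v u v).
Definition K_p (u v p : array) : array := (I_ X \ox I_ Y) (S_p u v p).

Local Notation h := (mesh_size X Y).

(* The right-hand sides of the three equations, as functions of the arrays
   dtu, dtv, dtp of the nodal time derivatives and of the unknowns. *)
Definition sugf_u (dtu dtp u v p : array) : array :=
  (M_ X \ox M_ Y) dtu + (Dlo_ X \ox M_ Y) (p - K_u u v)
  + (alpha * h) *: ((Dup_ X \ox M_ Y) dtp
                    + (Dlu_ X \ox Dlo_ Y) (U_ u + V_ v - K_p u v p)).

Definition sugf_v (dtv dtp u v p : array) : array :=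
  (M_ X \ox M_ Y) dtv + (M_ X \ox Dlo_ Y) (p - K_v u v)
  + (alpha * h) *: ((M_ X \ox Dup_ Y) dtp
                    + (Dlo_ X \ox Dlu_ Y) (U_ u + V_ v - K_p u v p)).

Definition sugf_p (dtu dtv dtp u v p : array) : array :=
  (M_ X \ox M_ Y) dtp + (Dlo_ X \ox Dlo_ Y) (U_ u + V_ v - K_p u v p)
  + (alpha * h) *: ((Dup_ X \ox M_ Y) dtu + (Dlu_ X \ox M_ Y) (p - K_u u v))
  + (alpha * h) *: ((M_ X \ox Dup_ Y) dtv + (M_ X \ox Dlu_ Y) (p - K_v u v)).

(* The parts without time derivative vanish, in every component. *)
Definition steady_state (u v p : array) : Prop :=
  [/\ sugf_u 0 0 u v p = 0, sugf_v 0 0 u v p = 0 & sugf_p 0 0 0 u v p = 0].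

Definition condA (u v p : array) : Prop :=
  exists (sigma_yu sigma_yp : 'I_(nb Y) -> R)
         (sigma_xv sigma_xp : 'I_(nb X) -> R),
  forall (a : 'I_(nb X)) (b : 'I_(nb Y)),
  [/\ p a b - K_u u v a b = sigma_yu b,
      p a b - K_v u v a b = sigma_xv a &
      U_ u a b + V_ v a b - K_p u v p a b = sigma_xp a + sigma_yp b].

Definition condB (u v p : array) : Prop :=
  forall (i : 'I_(gcells X)) (j : 'I_(gcells Y))
         (s : 'I_(gdeg X).+1) (t : 'I_(gdeg Y).+1),
  [/\ \int[lebesgue_measure]_(x in `[pt X i 0, pt X i s])
        (dx_interp p i j x (pt Y j t) - interp (S_u u v) i j x (pt Y j t)) = 0,
      \int[lebesgue_measure]_(y in `[pt Y j 0, pt Y j t])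
        (dy_interp p i j (pt X i s) y - interp (S_v u v) i j (pt X i s) y) = 0 &
      \int[lebesgue_measure]_(x in `[pt X i 0, pt X i s])
        (\int[lebesgue_measure]_(y in `[pt Y j 0, pt Y j t])
           (dx_interp u i j x y + dy_interp v i j x y
            - interp (S_p u v p) i j x y)) = 0].

End Scheme.

(* Main.v *)
Require Import Defs.
From HB Require Import structures.
From mathcomp Require Import all_boot all_order all_algebra.
From mathcomp Require Import all_classical all_reals all_analysis.
From mathcomp Require Import ring.

Set Implicit Arguments.
Unset Strict Implicit.
Unset Printing Implicit Defensive.

Import Order.TTheory GRing.Theory Num.Theory.
Import numFieldNormedType.Exports.

Local Open Scope ring_scope.

(** Every spatial term of the scheme applies a matrix with a derivative on the
    trial function (D_x or D^x_x, or their analogues in y) to one of the three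
    global fluxes p - K_u, p - K_v and U + V - K_p.  The shape functions of a
    cell add up to 1, so the derivatives of the shape functions add up to 0 and
    the rows of these matrices sum to 0 ([sum_Dlo], [sum_Dlu]): they annihilate
    arrays that are constant in their own direction ([kron_eq0l],
    [kron_eq0r]).  Under condition (A), p - K_u is constant in x, p - K_v is
    constant in y, and U + V - K_p is the sum of an array constant in y and an
    array constant in x; as the latter flux is differentiated in both
    directions in all three equations, every term vanishes
    ([condA_steady]).

    Condition (B) implies condition (A) ([condB_condA]).  On one cell, the
    functional that integrates from the left end to a node acts on the
    derivative of a shape function as a difference of point values
    ([defint_deriv_phi]) and on the shape function itself as a difference of
    rows of the integration matrix ([defint_phi]).  Hence the integrals in (B)
    are exactly the differences, between nodes of one cell, of p - K_u in x and
    of p - K_v in y, and the mixed second differences of U + V - K_p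
    ([int_dx], [int_dy], [int_div]).  Adjacent cells share a node, so if all
    these differences vanish cell by cell, they vanish on the whole grid
    ([node_constant]); an array without mixed second differences is the sum of
    a function of the x-node and a function of the y-node ([separated]). *)

(** * Definite integrals of polynomials *)

Section PolynomialIntegral.
Context (R : realType).
Implicit Types (p : {poly R}) (a b : R).

Definition antideriv p : {poly R} :=
  \poly_(i < (size p).+1) (p`_i.-1 / i%:R).

(** At index 0 the formula reads p`_0 / 0, which is 0 by the convention on
    inverses; thus it needs no case distinction and is visibly linear in p. *)
Lemma coef_antideriv p i : (antideriv p)`_i = p`_i.-1 / i%:R.
Proof.
rewrite coef_poly; case: ltnP => // hi.
by case: i hi => //= i hi; rewrite nth_default ?mul0r.
Qed.

Lemma antiderivK p : (antideriv p)^`() = p.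
Proof.
apply/polyP => i; rewrite coef_deriv coef_antideriv /=.
by rewrite -[LHS]mulr_natr divfK // pnatr_eq0.
Qed.

Lemma antideriv_is_linear : linear antideriv.
Proof.
move=> c p q; apply/polyP => i.
by rewrite !(coefD, coefZ, coef_antideriv) mulrDl mulrA.
Qed.

HB.instance Definition _ :=
  GRing.isLinear.Build R {poly R} {poly R} _ antideriv antideriv_is_linear.

Definition defint a b p : R := (antideriv p).[b] - (antideriv p).[a].

Lemma defint_is_linear a b : scalar (defint a b).
Proof.
move=> c p q; rewrite /defint linearP /= !(hornerD, hornerZ) mulrBr.
by rewrite opprD addrACA.
Qed.

HB.instance Definition _ a b :=
  GRing.isLinear.Build R {poly R} R _ (defint a b) (defint_is_linear a b).

Lemma Rintegral_deriv p a b : a <= b ->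
  \int[lebesgue_measure]_(x in `[a, b]) (p^`().[x]) = p.[b] - p.[a].
Proof.
rewrite le_eqVlt => /predU1P[<-|ab].
  by rewrite set_itv1 Rintegral_set1 subrr.
have cont q : (continuous (horner q : R -> R))%classic.
  exact: continuous_horner.
rewrite /Rintegral (@continuous_FTC2 _ _ (horner p)) //.
- exact: continuous_subspaceT.
- split.
  + by move=> x _; exact: derivable_horner.
  + by apply: cvg_at_right_filter; exact: cont.
  + by apply: cvg_at_left_filter; exact: cont.
- by move=> x _; rewrite derive1E; exact: derive_val.
Qed.

Lemma Rintegral_horner p a b : a <= b ->
  \int[lebesgue_measure]_(x in `[a, b]) (p.[x]) = defint a b p.
Proof. by move=> ab; rewrite /defint -Rintegral_deriv // antiderivK. Qed.

Lemma defint_deriv p a b : a <= b -> defint a b p^`() = p.[b] - p.[a].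
Proof. by move=> ab; rewrite -Rintegral_horner // Rintegral_deriv. Qed.

Lemma defint_id p a : defint a a p = 0.
Proof. exact: subrr. Qed.

End PolynomialIntegral.

(** * Lagrange bases on finitely many distinct points *)

Section Lagrange.
Context (F : fieldType) (n : nat).

(** The theory of Lagrange polynomials assumes sample points that form an
    injective sequence on all of nat.  Since only the first n points enter the
    polynomials, the other ones may be replaced to achieve this. *)
Lemma eq_lagrange (x y : nat -> F) :
  (forall k, (k < n)%N -> x k = y k) -> lagrange n x = lagrange n y.
Proof.
move=> xy; rewrite /lagrange !locked_withE; apply: eq_from_tnth => i.
rewrite !tnth_map tnth_ord_tuple /=; congr npolyp; rewrite xy //.
by under eq_bigr => j _ do rewrite xy //.
Qed.

End Lagrange.

(** * Nodes and shape functions of a grid *)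

Definition proper_grid (R : realType) (X : grid R) : Prop :=
  [/\ (0 < gdeg X)%N, (0 < gcells X)%N, glo X < ghi X &
      forall k l : nat, (k < l <= gdeg X)%N -> gref X k < gref X l].

Definition node (R : realType) (X : grid R) (i k : nat) : 'I_(nb X) :=
  inord (i * gdeg X + k).

Section Grid.
Context (R : realType) (X : grid R) (X_proper : proper_grid X).

Lemma nodeE i k : (i < gcells X)%N -> (k <= gdeg X)%N ->
  node X i k = (i * gdeg X + k)%N :> nat.
Proof.
move=> hi hk; rewrite inordK // ltnS.
apply: leq_trans (leq_mul hi (leqnn (gdeg X))).
by rewrite mulSn addnC leq_add2r.
Qed.

Lemma lt_pt i k l : (k < l <= gdeg X)%N -> pt X i k < pt X i l.
Proof.
case: X_proper => _ N0 lohi mono /mono kl.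
rewrite /pt ltrD2l ltr_pM2l ?ltr_pM2r ?ltrD2l //.
by rewrite divr_gt0 ?subr_gt0 // ltr0n.
Qed.

Lemma pt0_le i k : (k <= gdeg X)%N -> pt X i 0 <= pt X i k.
Proof.
by case: k => // k hk; apply/ltW/lt_pt.
Qed.

(** The points of a cell are extended beyond the degree by an increasing
    sequence, to make the theory of Lagrange polynomials applicable. *)
Lemma lagrange_pt_inj i : exists x : nat -> R,
  [/\ injective x, forall k, (k <= gdeg X)%N -> x k = pt X i k &
      lagrange (gdeg X).+1 (pt X i) = lagrange (gdeg X).+1 x].
Proof.
pose x k := if (k <= gdeg X)%N then pt X i k else pt X i (gdeg X) + k%:R.
have xE k : (k <= gdeg X)%N -> x k = pt X i k by rewrite /x => ->.
have x_incr k l : (k < l)%N -> x k < x l.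
  move=> kl; rewrite /x; case: (leqP l) => lK.
    by rewrite (leq_trans (ltnW kl) lK) lt_pt // kl.
  case: leqP => kK; last by rewrite ltrD2l ltr_nat.
  apply: (@le_lt_trans _ _ (pt X i (gdeg X))).
    by move: kK; rewrite leq_eqVlt => /predU1P[->//|kK]; apply/ltW/lt_pt/andP.
  by rewrite ltrDl ltr0n (leq_trans _ lK).
exists x; split => //.
  move=> k l xkl; case: (ltngtP k l) => // /x_incr;
  by rewrite xkl ltxx.
by apply: eq_lagrange => k; rewrite ltnS => /xE.
Qed.

Lemma lagr_pt i (k l : 'I_(gdeg X).+1) :
  (lagr i k).[pt X i l] = (k == l)%:R.
Proof.
have [x [x_inj xE eqL]] := lagrange_pt_inj i.
rewrite /lagr eqL -xE; last by rewrite -ltnS.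
exact: lagrange_sample.
Qed.

(** Lagrange interpolation of degree K reproduces the constant 1. *)
Lemma sum_lagr i : \sum_(k < (gdeg X).+1) @lagr R X i k = 1.
Proof.
have [x [x_inj _ eqL]] := lagrange_pt_inj i.
have -> : 1 = \sum_(k < (gdeg X).+1)
    (1 : {poly R}).[x k]%:P * tnth (lagrange (gdeg X).+1 x) k.
  by apply: lagrange_gen => //; rewrite size_polyC oner_eq0.
by apply: eq_bigr => k _; rewrite /lagr eqL hornerE mul1r.
Qed.

Lemma phi_pt i k a : (i < gcells X)%N -> (k <= gdeg X)%N ->
  (phi i a).[pt X i k] = (a == node X i k)%:R.
Proof.
move=> hi hk; rewrite /phi horner_sum.
have kP : (k < (gdeg X).+1)%N by [].
under eq_bigr => l _ do rewrite (lagr_pt i l (Ordinal kP)).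
rewrite -(inj_eq val_inj) /= nodeE //.
have [->|ne] := eqVneq (a : nat) (i * gdeg X + k)%N.
  rewrite (bigD1 (Ordinal kP)) //= eqxx big1 ?addr0 // => l.
  by case/andP => _ /negPf ->.
rewrite big1 // => l /eqP la; case: eqP => // lk.
by rewrite -la lk /= eqxx in ne.
Qed.

Lemma sum_phi i : (i < gcells X)%N -> \sum_a @phi R X i a = 1.
Proof.
move=> hi; rewrite -(sum_lagr i) /phi (exchange_big_dep predT) //=.
apply: eq_bigr => k _.
have hk : (k <= gdeg X)%N by rewrite -ltnS.
rewrite (big_pred1 (node X i k)) // => a /=.
by rewrite -(inj_eq val_inj) /= nodeE // eq_sym.
Qed.

(** Summing over the trial functions under the quadrature gives the derivative
    of the constant 1. *)
Lemma sum_quad_deriv i (g : R -> R) : (i < gcells X)%N ->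
  \sum_b quad X i (fun x => g x * ((@phi R X i b)^`()).[x]) = 0.
Proof.
move=> hi; rewrite /quad exchange_big /= big1 // => k _.
rewrite -mulr_sumr -mulr_sumr -horner_sum -linear_sum /= sum_phi //.
by rewrite -[1]/(1%:P) derivC horner0 !mulr0.
Qed.

Lemma sum_Dlo a : \sum_b Dlo_ X a b = 0.
Proof.
under eq_bigr => b _ do rewrite mxE.
by rewrite exchange_big big1 //= => i _; rewrite sum_quad_deriv.
Qed.

Lemma sum_Dlu a : \sum_b Dlu_ X a b = 0.
Proof.
under eq_bigr => b _ do rewrite mxE.
by rewrite exchange_big big1 //= => i _; rewrite sum_quad_deriv.
Qed.

(** The definition of the primitive assigns the right end of a cell to the
    next cell.  There the primitive is the start value of the next cell, which
    continues the one of this cell, so the formula holds for k = K as well. *)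
Lemma I_node i k b : (i < gcells X)%N -> (k <= gdeg X)%N ->
  I_ X (node X i k) b =
  I_ X (node X i 0) b + defint (pt X i 0) (pt X i k) (phi i b).
Proof.
case: X_proper => K0 _ _ _ hi.
have int_delta j l : (l <= gdeg X)%N ->
    \int[lebesgue_measure]_(x in `[pt X j 0, pt X j l])
      interp1 (fun c : 'I_(nb X) => (c == b)%:R) j x =
    defint (pt X j 0) (pt X j l) (phi j b).
  move=> lK; rewrite -Rintegral_horner ?pt0_le //.
  apply: eq_Rintegral => x _; rewrite /interp1 (bigD1 b) //= eqxx mul1r.
  by rewrite big1 ?addr0 // => c /negPf ->; rewrite mul0r.
have I_lt l : (l < gdeg X)%N -> I_ X (node X i l) b =
    prim_start (fun c : 'I_(nb X) => (c == b)%:R) i +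
    defint (pt X i 0) (pt X i l) (phi i b).
  move=> lK; rewrite mxE /prim nodeE //; last exact: ltnW.
  rewrite divnMDl // divn_small // addn0 modnMDl modn_small //.
  by rewrite int_delta // ltnW.
rewrite (I_lt 0) // defint_id addr0 leq_eqVlt.
move=> /predU1P[->|]; last exact: I_lt.
rewrite mxE /prim nodeE // -mulSnr mulnK // modnMl /= !int_delta //.
by rewrite defint_id addr0.
Qed.

Lemma defint_phi i k a : (i < gcells X)%N -> (k <= gdeg X)%N ->
  defint (pt X i 0) (pt X i k) (phi i a) =
  I_ X (node X i k) a - I_ X (node X i 0) a.
Proof. by move=> hi hk; rewrite (I_node a hi hk) addrC addKr. Qed.

Lemma defint_deriv_phi i k a : (i < gcells X)%N -> (k <= gdeg X)%N ->
  defint (pt X i 0) (pt X i k) (phi i a)^`() =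
  1%:M (node X i k) a - 1%:M (node X i 0) a.
Proof.
move=> hi hk; rewrite defint_deriv ?pt0_le // !phi_pt // !mxE.
by rewrite ![a == _]eq_sym.
Qed.

Lemma node_surj (a : 'I_(nb X)) : exists i k,
  [/\ (i < gcells X)%N, (k <= gdeg X)%N & a = node X i k].
Proof.
case: X_proper => K0 N0 _ _.
have := ltn_ord a; rewrite ltnS leq_eqVlt => /predU1P[aN|aN].
  exists (gcells X).-1, (gdeg X); split; rewrite ?prednK //.
  by apply: val_inj; rewrite /= nodeE ?prednK // -mulSnr prednK.
have ai : (a %/ gdeg X < gcells X)%N by rewrite ltn_divLR.
have ak : (a %% gdeg X <= gdeg X)%N by rewrite ltnW // ltn_mod.
exists (a %/ gdeg X)%N, (a %% gdeg X)%N; split => //.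
by apply: val_inj; rewrite /= nodeE // -divn_eq.
Qed.

(** Constancy propagates through the grid because the last node of a cell is
    the first node of the next one. *)
Lemma node_constant (T : Type) (f : 'I_(nb X) -> T) :
  (forall i k, (i < gcells X)%N -> (k <= gdeg X)%N ->
     f (node X i k) = f (node X i 0)) ->
  forall a, f a = f ord0.
Proof.
case: X_proper => K0 N0 _ _ hf.
have left0 i : (i < gcells X)%N -> f (node X i 0) = f ord0.
  elim: i => [|i IH] hi; first by congr f; apply: val_inj; rewrite /= nodeE.
  have hi' := ltnW hi; rewrite -IH // -(hf i (gdeg X)) //.
  by congr f; apply: val_inj; rewrite /= !nodeE // mulSnr addn0.
move=> a; have [i [k [hi hk ->]]] := node_surj a.
by rewrite hf // left0.
Qed.

End Grid.

(** * Tensor products *)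

Section Pairing.
Context (R : realType) (m n : nat).
Implicit Types (F : 'I_m -> R) (G : 'I_n -> R) (q : 'M[R]_(m, n)).

(** Point values of interpolants, their integrals over cells and the entries of
    [(A \ox B) q] all have this form, for suitable linear functionals F and G
    given by their values on the shape functions; this reduces the conditions on
    integrals to identities between the functionals. *)
Definition pairing F G q : R := \sum_a \sum_b q a b * (F a * G b).

Lemma kronE (A : 'M[R]_m) (B : 'M[R]_n) q a b :
  (A \ox B) q a b = pairing (A a) (B b) q.
Proof.
by rewrite mxE; apply: eq_bigr => a' _; apply: eq_bigr => b' _; rewrite mulrC.
Qed.

Lemma addmxE q q' a b : (q + q') a b = q a b + q' a b.
Proof. by rewrite mxE. Qed.

Lemma submxE q q' a b : (q - q') a b = q a b - q' a b.
Proof. by rewrite !mxE. Qed.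

Lemma eq_pairing F F' G G' q : F =1 F' -> G =1 G' ->
  pairing F G q = pairing F' G' q.
Proof.
by move=> hF hG; apply: eq_bigr => a _; apply: eq_bigr => b _; rewrite hF hG.
Qed.

Lemma pairingBl F F' G q :
  pairing (fun a => F a - F' a) G q = pairing F G q - pairing F' G q.
Proof.
rewrite /pairing -sumrB; apply: eq_bigr => a _; rewrite -sumrB.
by apply: eq_bigr => b _; rewrite mulrBl mulrBr.
Qed.

Lemma pairingBr F G G' q :
  pairing F (fun b => G b - G' b) q = pairing F G q - pairing F G' q.
Proof.
rewrite /pairing -sumrB; apply: eq_bigr => a _; rewrite -sumrB.
by apply: eq_bigr => b _; rewrite !mulrBr.
Qed.

(** As a function of one coordinate, a pairing with point evaluation is a
    polynomial r, and integrating r amounts to replacing the evaluation by the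
    integral.  Passing through r avoids all questions of integrability. *)
Lemma pairing_hornerl (P : 'I_m -> {poly R}) G q : exists r : {poly R},
  (forall x, pairing (fun a => (P a).[x]) G q = r.[x]) /\
  (forall c d, pairing (fun a => defint c d (P a)) G q = defint c d r).
Proof.
exists (\sum_a \sum_b (q a b * G b) *: P a); split=> [x|c d];
  rewrite ?horner_sum ?linear_sum /=; apply: eq_bigr => a _;
  rewrite ?horner_sum ?linear_sum /=; apply: eq_bigr => b _;
  by rewrite ?hornerZ ?linearZ /= -mulrA [G b * _]mulrC.
Qed.

Lemma pairing_hornerr F (Q : 'I_n -> {poly R}) q : exists r : {poly R},
  (forall y, pairing F (fun b => (Q b).[y]) q = r.[y]) /\
  (forall c d, pairing F (fun b => defint c d (Q b)) q = defint c d r).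
Proof.
exists (\sum_a \sum_b (q a b * F a) *: Q b); split=> [y|c d];
  rewrite ?horner_sum ?linear_sum /=; apply: eq_bigr => a _;
  rewrite ?horner_sum ?linear_sum /=; apply: eq_bigr => b _;
  by rewrite ?hornerZ ?linearZ /= -mulrA.
Qed.

Lemma kron_eq0l (A : 'M[R]_m) (B : 'M[R]_n) q (s : 'I_n -> R) :
  (forall a, \sum_a' A a a' = 0) -> (forall a b, q a b = s b) ->
  (A \ox B) q = 0.
Proof.
move=> A0 qs; apply/matrixP => a b; rewrite !mxE exchange_big big1 //= => b' _.
under eq_bigr => a' _ do rewrite qs -mulrA.
by rewrite -mulr_suml A0 mul0r.
Qed.

Lemma kron_eq0r (A : 'M[R]_m) (B : 'M[R]_n) q (s : 'I_m -> R) :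
  (forall b, \sum_b' B b b' = 0) -> (forall a b, q a b = s a) ->
  (A \ox B) q = 0.
Proof.
move=> B0 qs; apply/matrixP => a b; rewrite !mxE big1 //= => a' _.
under eq_bigr => b' _ do rewrite qs mulrAC.
by rewrite -mulr_sumr B0 mulr0.
Qed.

Lemma kronD (A : 'M[R]_m) (B : 'M[R]_n) q q' :
  (A \ox B) (q + q') = (A \ox B) q + (A \ox B) q'.
Proof.
apply/matrixP => a b; rewrite !mxE -big_split; apply: eq_bigr => a' _.
by rewrite -big_split; apply: eq_bigr => b' _; rewrite mxE mulrDr.
Qed.

Lemma kron_0 (A : 'M[R]_m) (B : 'M[R]_n) : (A \ox B) 0 = 0.
Proof. by apply: (@addrI _ ((A \ox B) 0)); rewrite -kronD !addr0. Qed.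

Lemma kron_11 q : (1%:M \ox 1%:M) q = q.
Proof.
apply/matrixP => a b; rewrite mxE (bigD1 a) //= (bigD1 b) //= !mxE !eqxx !mul1r.
rewrite !big1 ?addr0 // => c /negPf ne.
  by rewrite big1 // => d _; rewrite !mxE eq_sym ne !mul0r.
by rewrite !mxE [b == c]eq_sym ne mulr0 mul0r.
Qed.

End Pairing.

(** * The integrals over one cell as differences of the global fluxes *)

Section Cell.
Context (R : realType) (X Y : grid R).
Context (X_proper : proper_grid X) (Y_proper : proper_grid Y).
Implicit Types u v p S : 'M[R]_(nb X, nb Y).

(** The integral of the x-derivative of p is a difference of nodal values of p,
    and the integral of the interpolated source is the matching difference of
    its primitive. *)
Lemma int_dx p S i j s t : (i < gcells X)%N -> (s <= gdeg X)%N ->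
    (j < gcells Y)%N -> (t <= gdeg Y)%N ->
  let W := p - (I_ X \ox 1%:M) S in
  \int[lebesgue_measure]_(x in `[pt X i 0, pt X i s])
     (dx_interp p i j x (pt Y j t) - interp S i j x (pt Y j t)) =
  W (node X i s) (node Y j t) - W (node X i 0) (node Y j t).
Proof.
move=> hi hs hj ht W.
have evalY (b : 'I_(nb Y)) : (phi j b).[pt Y j t] = 1%:M (node Y j t) b.
  by rewrite phi_pt // mxE eq_sym.
have [rp [rpE rpI]] := pairing_hornerl (fun a => (phi i a)^`())
  (fun b => (phi j b).[pt Y j t]) p.
have [rS [rSE rSI]] := pairing_hornerl (fun a => phi i a)
  (fun b => (phi j b).[pt Y j t]) S.
rewrite (_ : (fun x : R => _) = horner (rp - rS)); last first.
  by apply/funext => x; rewrite hornerD hornerN -rpE -rSE.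
rewrite Rintegral_horner ?pt0_le // linearB /= -rpI -rSI.
rewrite (eq_pairing _ (fun a => defint_deriv_phi X_proper a hi hs) evalY).
rewrite (eq_pairing _ (fun a => defint_phi X_proper a hi hs) evalY).
rewrite !pairingBl -!kronE kron_11 /W !submxE; ring.
Qed.

Lemma int_dy p S i j s t : (i < gcells X)%N -> (s <= gdeg X)%N ->
    (j < gcells Y)%N -> (t <= gdeg Y)%N ->
  let W := p - (1%:M \ox I_ Y) S in
  \int[lebesgue_measure]_(y in `[pt Y j 0, pt Y j t])
     (dy_interp p i j (pt X i s) y - interp S i j (pt X i s) y) =
  W (node X i s) (node Y j t) - W (node X i s) (node Y j 0).
Proof.
move=> hi hs hj ht W.
have evalX (a : 'I_(nb X)) : (phi i a).[pt X i s] = 1%:M (node X i s) a.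
  by rewrite phi_pt // mxE eq_sym.
have [rp [rpE rpI]] := pairing_hornerr (fun a => (phi i a).[pt X i s])
  (fun b => (phi j b)^`()) p.
have [rS [rSE rSI]] := pairing_hornerr (fun a => (phi i a).[pt X i s])
  (fun b => phi j b) S.
rewrite (_ : (fun y : R => _) = horner (rp - rS)); last first.
  by apply/funext => y; rewrite hornerD hornerN -rpE -rSE.
rewrite Rintegral_horner ?pt0_le // linearB /= -rpI -rSI.
rewrite (eq_pairing _ evalX (fun b => defint_deriv_phi Y_proper b hj ht)).
rewrite (eq_pairing _ evalX (fun b => defint_phi Y_proper b hj ht)).
rewrite !pairingBr -!kronE kron_11 /W !submxE; ring.
Qed.

(** Integrating the x-derivative of u in x gives a difference, and the
    integration in y then gives a difference of U = I_y u; so the contribution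
    of u is a mixed second difference of U.  The contributions of v and of the
    source are mixed second differences of V and K_p for the same reason. *)
Lemma int_div u v S i j s t : (i < gcells X)%N -> (s <= gdeg X)%N ->
    (j < gcells Y)%N -> (t <= gdeg Y)%N ->
  let W := U_ u + V_ v - (I_ X \ox I_ Y) S in
  \int[lebesgue_measure]_(x in `[pt X i 0, pt X i s])
     (\int[lebesgue_measure]_(y in `[pt Y j 0, pt Y j t])
        (dx_interp u i j x y + dy_interp v i j x y - interp S i j x y)) =
  (W (node X i s) (node Y j t) - W (node X i 0) (node Y j t)) -
  (W (node X i s) (node Y j 0) - W (node X i 0) (node Y j 0)).
Proof.
move=> hi hs hj ht W.
pose Jy := defint (pt Y j 0) (pt Y j t).
(* The inner integral is again a combination of pairings, hence a polynomial
   in x. *)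
have inner x : \int[lebesgue_measure]_(y in `[pt Y j 0, pt Y j t])
      (dx_interp u i j x y + dy_interp v i j x y - interp S i j x y) =
    pairing (fun a => ((phi i a)^`()).[x]) (fun b => Jy (phi j b)) u +
    pairing (fun a => (phi i a).[x]) (fun b => Jy (phi j b)^`()) v -
    pairing (fun a => (phi i a).[x]) (fun b => Jy (phi j b)) S.
  have [ru [ruE ruI]] := pairing_hornerr (fun a => ((phi i a)^`()).[x])
    (fun b => phi j b) u.
  have [rv [rvE rvI]] := pairing_hornerr (fun a => (phi i a).[x])
    (fun b => (phi j b)^`()) v.
  have [rS [rSE rSI]] := pairing_hornerr (fun a => (phi i a).[x])
    (fun b => phi j b) S.
  rewrite (_ : (fun y : R => _) = horner (ru + rv - rS)); last first.
    by apply/funext => y; rewrite !hornerD hornerN -ruE -rvE -rSE.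
  by rewrite Rintegral_horner ?pt0_le // linearB linearD /= ruI rvI rSI.
have [ru [ruE ruI]] := pairing_hornerl (fun a => (phi i a)^`())
  (fun b => Jy (phi j b)) u.
have [rv [rvE rvI]] := pairing_hornerl (fun a => phi i a)
  (fun b => Jy (phi j b)^`()) v.
have [rS [rSE rSI]] := pairing_hornerl (fun a => phi i a)
  (fun b => Jy (phi j b)) S.
rewrite (_ : (fun x : R => _) = horner (ru + rv - rS)); last first.
  by apply/funext => x; rewrite inner !hornerD hornerN -ruE -rvE -rSE.
rewrite Rintegral_horner ?pt0_le // linearB linearD /= -ruI -rvI -rSI /Jy.
rewrite (eq_pairing _ (fun a => defint_deriv_phi X_proper a hi hs)
                      (fun b => defint_phi Y_proper b hj ht)).
rewrite (eq_pairing _ (fun a => defint_phi X_proper a hi hs)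
                      (fun b => defint_deriv_phi Y_proper b hj ht)).
rewrite (eq_pairing _ (fun a => defint_phi X_proper a hi hs)
                      (fun b => defint_phi Y_proper b hj ht)).
by rewrite !pairingBl !pairingBr -!kronE /W !(submxE, addmxE) /U_ /V_; ring.
Qed.

(** For a fixed pair of nodes of one cell in x, the difference of W between
    them does not depend on y; hence W a b - W a ord0 does not depend on a. *)
Lemma separated W :
  (forall i j s t, (i < gcells X)%N -> (s <= gdeg X)%N ->
     (j < gcells Y)%N -> (t <= gdeg Y)%N ->
     W (node X i s) (node Y j t) - W (node X i 0) (node Y j t) =
     W (node X i s) (node Y j 0) - W (node X i 0) (node Y j 0)) ->
  forall a b, W a b = W a ord0 + (W ord0 b - W ord0 ord0) :> R.
Proof.
move=> hW a b; suff : W a b - W a ord0 = W ord0 b - W ord0 ord0.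
  by move=> <-; rewrite addrC subrK.
apply: (node_constant X_proper (f := fun a => W a b - W a ord0)) => i s hi hs.
have := @node_constant _ _ Y_proper _
  (fun b => W (node X i s) b - W (node X i 0) b).
move=> /(_ (fun j t hj ht => hW i j s t hi hs hj ht) b) eqb.
rewrite -[W _ b in LHS](subrK (W (node X i 0) b)) eqb; ring.
Qed.

End Cell.

(** * Steady states *)

Section Steady.
Context (R : realType) (X Y : grid R) (alpha : R) (S : sources R).
Context (X_proper : proper_grid X) (Y_proper : proper_grid Y).
Implicit Types u v p : 'M[R]_(nb X, nb Y).

Lemma condA_steady u v p : condA S u v p -> steady_state alpha S u v p.
Proof.
case=> su [sp [sv [sx hA]]].
have Eu a b : (p - K_u S u v) a b = su b.
  by rewrite submxE; case: (hA a b).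
have Ev a b : (p - K_v S u v) a b = sv a.
  by rewrite submxE; case: (hA a b).
have Ep : U_ u + V_ v - K_p S u v p
    = (\matrix_(a, b) sx a) + (\matrix_(a, b) sp b).
  apply/matrixP => a b; rewrite submxE !addmxE.
  by have [_ _ ->] := hA a b; rewrite !mxE.
have Ex a b : (\matrix_(a, b) sx a : 'M[R]_(nb X, nb Y)) a b = sx a.
  by rewrite mxE.
have Ey a b : (\matrix_(a, b) sp b : 'M[R]_(nb X, nb Y)) a b = sp b.
  by rewrite mxE.
have kill (A : 'M[R]_(nb X)) (B : 'M[R]_(nb Y)) :
    (forall a, \sum_a' A a a' = 0) -> (forall b, \sum_b' B b b' = 0) ->
    (A \ox B) (U_ u + V_ v - K_p S u v p) = 0.
  move=> A0 B0; rewrite Ep kronD.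
  by rewrite (kron_eq0r A B0 Ex) (kron_eq0l B A0 Ey) addr0.
have DloX := sum_Dlo X_proper; have DluX := sum_Dlu X_proper.
have DloY := sum_Dlo Y_proper; have DluY := sum_Dlu Y_proper.
split; rewrite /sugf_u /sugf_v /sugf_p !kron_0 !kill //.
- by rewrite (kron_eq0l _ DloX Eu) !(addr0, scaler0).
- by rewrite (kron_eq0r _ DloY Ev) !(addr0, scaler0).
- by rewrite (kron_eq0l _ DluX Eu) (kron_eq0r _ DluY Ev) !(addr0, scaler0).
Qed.

(** The functions sigma are the values of the fluxes along the first row and
    the first column of nodes; for U + V - K_p the corner value, which occurs in
    both, is subtracted from one of them. *)
Lemma condB_condA u v p : condB S u v p -> condA S u v p.
Proof.
move=> hB.
have cell i j s t (hi : (i < gcells X)%N) (hs : (s <= gdeg X)%N)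
    (hj : (j < gcells Y)%N) (ht : (t <= gdeg Y)%N) :=
  hB (Ordinal hi) (Ordinal hj) (Ordinal (hs : (s < (gdeg X).+1)%N))
     (Ordinal (ht : (t < (gdeg Y).+1)%N)).
pose Wu := p - K_u S u v; pose Wv := p - K_v S u v.
pose Wp := U_ u + V_ v - K_p S u v p.
have Eu a b : Wu a b = Wu ord0 b.
  apply: (node_constant X_proper (f := fun a => Wu a b)) => i s hi hs.
  have [j [t [hj ht ->]]] := node_surj Y_proper b.
  by have [+ _ _] := cell i j s t hi hs hj ht; rewrite /= int_dx // => /eqP;
     rewrite subr_eq0 => /eqP.
have Ev a b : Wv a b = Wv a ord0.
  apply: (node_constant Y_proper (f := fun b => Wv a b)) => j t hj ht.
  have [i [s [hi hs ->]]] := node_surj X_proper a.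
  by have [_ + _] := cell i j s t hi hs hj ht; rewrite /= int_dy // => /eqP;
     rewrite subr_eq0 => /eqP.
have Ep : forall a b, Wp a b = Wp a ord0 + (Wp ord0 b - Wp ord0 ord0).
  apply: separated => // i j s t hi hs hj ht.
  by have [_ _ +] := cell i j s t hi hs hj ht; rewrite /= int_div // => /eqP;
     rewrite subr_eq0 => /eqP.
exists (Wu ord0), (fun b => Wp ord0 b - Wp ord0 ord0), (Wv^~ ord0), (Wp^~ ord0).
move=> a b; split.
- by rewrite -(Eu a) /Wu submxE.
- by rewrite -(Ev a b) /Wv submxE.
- by rewrite -Ep /Wp submxE addmxE.
Qed.

End Steady.

Theorem proposition8 (R : realType) (K Nx Ny : nat) (xi : nat -> R)
    (x0 xe y0 ye : R) (alpha : R) (S : sources R)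
    (hK : (1 <= K)%N) (hxi : gauss_lobatto K xi)
    (hx : x0 < xe) (hy : y0 < ye) (hNx : (1 <= Nx)%N) (hNy : (1 <= Ny)%N) :
  let X := Grid K xi x0 xe Nx in
  let Y := Grid K xi y0 ye Ny in
  forall u v p : 'M[R]_(nb X, nb Y),
    (condA S u v p -> steady_state alpha S u v p) /\
    (condB S u v p -> steady_state alpha S u v p).
Proof.
move=> X Y u v p; case: hxi => _ _ xi_incr _.
have X_proper : proper_grid X by [].
have Y_proper : proper_grid Y by [].
split; first exact: condA_steady.
by move=> /(condB_condA X_proper Y_proper); exact: condA_steady.
Qed.
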